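(* Let $l\in\mathbb{N}$ and let $x_1,x_2\in S_n$ be such that $\langle x_1,x_2\rangle$ is a non-commutative subgroup of $S_n$ of order $2^{l+1}$, with $o(x_1)=2^l$ and $o(x_2)=2$. Suppose there is $y\in S_n$ with $y^2=x_1^{-1}$, and suppose $x_2y^{-1}=y^{-k}x_2$ for some odd integer $k$ with $k\not\equiv -1\pmod{2^{l+1}}$. Then $\langle x_1,x_2\rangle$ is not a perfect code of $S_n$.
   Context: $o(g)$ denotes the order of $g$. For a group $G$ and a subset $S\subseteq G\setminus\{1_G\}$ with $S=S^{-1}$, the Cayley graph $\mathrm{Cay}(G,S)$ has vertex set $G$, with $g$ and $h$ adjacent iff $hg^{-1}\in S$. A perfect code in a graph is a set $C$ of vertices, no two adjacent, such that every vertex outside $C$ is adjacent to exactly one vertex of $C$. A subgroup $H$ of $G$ is a perfect code of $G$ if some Cayley graph $\mathrm{Cay}(G,S)$ of $G$ has $H$ as a perfect code. *)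

(* Defs.v *)
From mathcomp Require Import all_boot all_order all_algebra all_fingroup.

Set Implicit Arguments.
Unset Strict Implicit.
Unset Printing Implicit Defensive.

Local Open Scope group_scope.

(* [e] is the adjacency relation of the graph; a loopless graph is expected,
   so letting [u = v] in the first clause is harmless. *)
Definition perfect_code (T : finType) (e : rel T) (C : {set T}) : Prop :=
  {in C &, forall u v, ~~ e u v} /\
  (forall v, v \notin C -> #|[set u in C | e v u]| = 1%N).

(* [S^-1] is the set of inverses of the elements of [S]. *)
Definition connection_set (gT : finGroupType) (S : {set gT}) : Prop :=
  1 \notin S /\ S^-1 = S.

Definition cayley (gT : finGroupType) (S : {set gT}) : rel gT :=
  fun g h => h * g^-1 \in S.

(* The ambient group is the whole type [gT]. *)
Definition subgroup_perfect_code (gT : finGroupType) (H : {group gT}) : Prop :=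
  exists S : {set gT}, connection_set S /\ perfect_code (cayley S) H.

(* The group library only provides natural-number exponents; note that
   [Negz m] stands for the integer -(m + 1). *)
Definition expgz (gT : finGroupType) (x : gT) (k : int) : gT :=
  match k with
  | Posz m => x ^+ m
  | Negz m => x ^- m.+1
  end.

(* Main.v *)
Require Import Defs.
From mathcomp Require Import all_boot all_order all_algebra all_fingroup.
From mathcomp Require Import all_solvable zify.

(** If [H] is a perfect code and [g], outside [H], normalises [H] and squares into [H],
    then the coset [H g] is closed under inversion and meets the connection set in
    exactly one element, which is therefore its own inverse.  For [H] generated
    by [x1] and [x2], the element [y^-1] is such a [g], and every element of
    [H y^-1] is either [w] or [w x2], where [w] is an odd power of [y] and thus
    has order [2 ^ l.+1]; the relation [x2 y^-1 = y^-k x2] gives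
    [(w x2) ^+ 2 = w ^+ (k + 1)], so none of these elements squares to [1]. *)

Local Open Scope group_scope.

Lemma perfect_code_coset_sqr1 (gT : finGroupType) (H : {group gT}) (g : gT) :
    subgroup_perfect_code H -> g \in 'N(H) -> g ^+ 2 \in H ->
  exists2 u, u \in H & (u * g) ^+ 2 = 1.
Proof.
move=> [S [[_ SV] [_ codeH]]] nHg Hgg.
have [Hg | H'g] := boolP (g \in H).
  by exists g^-1; rewrite ?groupV // mulVg expg1n.
have H'gV : g^-1 \notin H by rewrite groupV.
(* The vertex [g^-1] is adjacent to [v] exactly when [v * g] lies in [S]. *)
have /eqP/cards1P[u defu] := codeH _ H'gV.
have mem_u v : (v \in H) && (v * g \in S) = (v == u).
  by rewrite -in_set1 -defu inE /cayley invgK.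
have /andP[Hu Sug] : (u \in H) && (u * g \in S) by rewrite mem_u.
exists u => //.
(* The inverse of [u * g] is [(g^-1 * u^-1 * g^-1) * g], again in [S] and in the coset [H g], so
   uniqueness of [u] applies. *)
have /eqP defu' : g^-1 * u^-1 * g^-1 == u.
  have Sgu : g^-1 * u^-1 \in S by rewrite -invMg -SV mem_invg invgK.
  rewrite -mem_u mulgKV Sgu andbT.
  have -> : g^-1 * u^-1 * g^-1 = u^-1 ^ g * g ^- 2.
    by rewrite conjgE -expgVn !mulgA mulgK.
  by rewrite groupM ?memJ_norm ?groupV.
by rewrite expgS expg1 -{1}defu' mulgKV -invMg mulVg.
Qed.

Lemma expgz_modz (gT : finGroupType) (x : gT) (k : int) :
  expgz x k = x ^+ `|(k %% #[x])%Z|%N.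
Proof.
case: k => n; first by rewrite modz_nat /= expg_mod_order.
rewrite modNz_nat ?order_gt0 //=.
have lt_n := ltn_pmod n (order_gt0 x).
have -> : `|(#[x]%:Z - 1 - (n %% #[x])%:Z)%R|%N = (#[x] - (n %% #[x]).+1)%N by lia.
apply: (mulgI (x ^+ n.+1)); rewrite mulgV -expgD.
have -> : (n.+1 + (#[x] - (n %% #[x]).+1) = #[x] * (n %/ #[x]).+1)%N.
  by rewrite mulnC mulSn; have := divn_eq n #[x]; lia.
by rewrite expgM expg_order expg1n.
Qed.

Local Close Scope group_scope.

Theorem theorem6 (n l : nat) (x1 x2 : 'S_n)
  (hnc : ~~ abelian <<[set x1; x2]>>%g)
  (hord : #|<<[set x1; x2]>>%g| = 2 ^ l.+1)
  (hx1 : #[x1]%g = 2 ^ l)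
  (hx2 : #[x2]%g = 2)
  (y : 'S_n) (hy : (y ^+ 2 = x1^-1)%g)
  (k : int) (hodd : ~~ (2 %| k)%Z)
  (hk : (k != -1 %[mod (2 ^ l.+1)%N])%Z)
  (hrel : (x2 * y^-1 = expgz y (- k)%R * x2)%g) :
  ~ subgroup_perfect_code <<[set x1; x2]>>%G.
Proof.
Local Open Scope group_scope.
have l_gt0 : 0 < l.
  rewrite lt0n; apply: contraNneq hnc => l0.
  by rewrite cyclic_abelian // prime_cyclic // hord l0.
(* As [0 < l], 2 divides the order of [y ^+ 2], so the order of [y] is twice that. *)
have oy : #[y] = (2 ^ l.+1)%N.
  by rewrite expnS (@orderXprime _ 2 (2 ^ l)) ?hy ?orderV ?dvdn_exp.
rewrite expgz_modz oy in hrel.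
(* [m] is the residue of [- k] modulo the order of [y]: it is odd like [k], and [hk] says that it is
   not 1. *)
set m := `|_|%N in hrel.
have defm : (m%:Z = (- k)%R %% (2 ^ l.+1)%N)%Z.
  by rewrite gez0_abs // modz_ge0 // eqz_nat expn_eq0.
have odd_m : odd m.
  move: hodd defm; rewrite /modz expnS; move: (divz _ _) => q; lia.
have m_neq1 : m != 1 %[mod 2 ^ l.+1].
  apply: contra hk => m1.
  have : (m == 1 %[mod (2 ^ l.+1)%N])%Z by rewrite !modz_nat eqz_nat.
  by rewrite defm modz_mod !eqz_mod_dvd -GRing.opprD GRing.rpredN GRing.opprK.
have x2V : x2^-1 = x2 by apply: invg2id.
have yJx2 : y ^ x2 = y ^- m.
  by apply: invg_inj; rewrite -conjVg invgK conjgE x2V mulgA hrel -mulgA -{1}x2V mulVg mulg1.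
have x1E : x1 = y ^- 2 by rewrite hy invgK.
set H := <<_>>%G.
have Hx1 : x1 \in H by rewrite mem_gen ?set21.
have Hx2 : x2 \in H by rewrite mem_gen ?set22.
have Hy2 q : y ^+ q.*2 \in H by rewrite -mul2n expgM hy groupX ?groupV.
have nHy : y^-1 \in 'N(H).
  rewrite inE -genJ gen_subG; apply/subsetP=> _ /imsetP[x /set2P[]-> ->].
    by rewrite x1E -expgVn conjXg conjgE mulKg expgVn -x1E.
  (* The conjugate of [x2] is [y ^+ m.+1 * x2], where [m.+1] is even. *)
  rewrite conjgE invgK hrel !mulgA -expgS groupM //.
  by rewrite -[m.+1]even_halfK //= odd_m.
have defH : H :=: <[x1]> * <[x2]>.
  rewrite -norm_joinEr ?norms_cycle; first by rewrite joing_idl joing_idr.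
  rewrite {1}x1E conjVg conjXg yJx2 expgVn invgK expgAC hy.
  by rewrite groupX ?groupV ?cycle_id.
move=> /perfect_code_coset_sqr1/(_ nHy)[|u].
  by rewrite expgVn -x1E.
have odd_order j : odd j -> #[y ^+ j] = (2 ^ l.+1)%N.
  move=> odd_j; rewrite orderXgcd oy (eqP (_ : coprime _ j)) ?divn1 //.
  by rewrite coprimeXl ?coprime2n.
(* [d] stands for the exponent -1, so that natural exponents suffice and only their parity has to be
   followed. *)
set d := (2 ^ l.+1).-1.
have odd_d : odd d by rewrite /d expnS mul2n; have := expn_gt0 2 l; lia.
have yV : y^-1 = y ^+ d by rewrite invg_expg oy.
have x1X i : x1 ^+ i = y ^+ (d * i).*2.
  by rewrite x1E -expgVn yV -!expgM -mul2n; congr (_ ^+ _); lia.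
rewrite defH (cycle2g hx2) => /mulsgP[_ x /cycleP[i ->] /set2P[] -> ->].
  rewrite mulg1 x1X yV -expgD => /eqP; rewrite -order_dvdn odd_order; last first.
    by rewrite oddD odd_double.
  by move/dvdn_leq=> /(_ isT); rewrite -{2}(expn1 2) leq_exp2l // ltnS leqNgt l_gt0.
rewrite -!mulgA hrel mulgA x1X -expgD; set j := (_ + m)%N.
have oj : #[y ^+ j] = (2 ^ l.+1)%N by rewrite odd_order // oddD odd_double.
(* For [w = y ^+ j], [(w * x2) ^+ 2 = w * w ^ x2 = w * w ^- m]; if this is 1, then [w ^+ m = w],
   which forces [m] to be 1 modulo the order of [w]. *)
rewrite expgS expg1 -mulgA -{1}x2V -conjgE conjXg yJx2 expgVn expgAC => wwV.
have /eqP : (y ^+ j) ^+ m = (y ^+ j) ^+ 1.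
  by apply/esym/eqP; rewrite expg1 eq_mulgV1 wwV.
by rewrite eq_expg_mod_order oj (negPf m_neq1).
Qed.
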